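(* For any quantum distributed algorithm (in the quantum routing model) solving some (unweighted) distributed graph problem $\mathcal{P}$ on some communication graph $G$ with communication cost (message complexity) $M$, there exists a (centralized) quantum algorithm which, given query access to the adjacency array of $G$, uses $M$ queries to solve $\mathcal{P}$ on $G$.
   Context: Quantum routing model. The network is an undirected graph $G=(V,E)$, $n=|V|$, unweighted. Each node $u$ has $\deg(u)$ numbered ports, each connected to one neighbour; nodes initially have only local knowledge (they do not know who is behind a port). For each port $p=(u,v)$, node $u$ holds an emission register $u\to v$ and a reception register $u\gets v$, each holding either an $O(\log n)$-qubit message or the empty symbol $\bot$. Nodes run the same algorithm in synchronous rounds. In each round: (1) every node applies the same local unitary to its local data, local memory and emission/reception registers; (2) the operator $\mathsf{Send}$ is applied, which for every ordered pair $(u,v)$ of neighbours swaps the contents of $u\to v$ (held by $u$) and $v\gets u$ (held by $v$). Outputs are obtained by measuring local registers. A round has message complexity $M$ if the global state of the network is a superposition of (deterministic) configurations in each of which at most $M$ non-empty messages are sent; the message complexity of an algorithm is the sum over its rounds. Adjacency array model (centralized, with strengthened queries). The input is a simple, undirected, unweighted graph on vertex set $\{1,\dots,n\}$ whose degrees $d_1,\dots,d_n$ are initially known; each vertex $v$ has an array $f_v:\{1,\dots,d_v\}\to\{1,\dots,n\}$ listing its neighbours. A query is a pair $(v,p)$ with $1\le p\le d_v$, and its answer is $(u,q)$ where $u=f_v(p)$ and $q$ is the rank of $v$ in $f_u$, i.e. $f_u(q)=v$. The ranks $p,q$ are interpreted as the port numbers of $v$ and $u$ in the distributed setting. Queries may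 be made in quantum superposition; the cost is the number of quantum queries, while memory and computation are unrestricted. *)

(* Defs.v *)
From HB Require Import structures.
From mathcomp Require Import all_boot all_order all_algebra.
From mathcomp Require Import spectral.
From mathcomp Require Import reals complex.

Set Implicit Arguments.
Unset Strict Implicit.
Unset Printing Implicit Defensive.

Import Order.TTheory GRing.Theory Num.Theory.
Local Open Scope ring_scope.
Local Open Scope complex_scope.

(* The Hilbert space with orthonormal basis [T]: a state is a family of amplitudes
   [psi x = <x|psi>], an operator is a kernel [U y x = <y|U|x>]. *)

Section Quantum.
Variables (R : realType) (T : finType).

Definition state := {ffun T -> R[i]}.
Definition operator := T -> T -> R[i].

Definition unitary (U : operator) : bool :=
  \matrix_(i < #|T|, j < #|T|) U (enum_val i) (enum_val j) \is unitarymx.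

Definition apply_op (U : operator) (psi : state) : state :=
  [ffun y => \sum_x U y x * psi x].

Definition basis_state (x0 : T) : state := [ffun x => (x == x0)%:R].

Definition basis_map (f : T -> T) : operator := fun y x => (y == f x)%:R.

Definition measure_prob (psi : state) (E : pred T) : R[i] :=
  \sum_(x | E x) `|psi x| ^+ 2.
End Quantum.

(* A pair (v, p), where p is a port number of v; numbering starts at 0. *)
Definition port (n : nat) (d : 'I_n -> nat) : finType := {v : 'I_n & 'I_(d v)}.

Record network (n : nat) (d : 'I_n -> nat) := Network {
  edge : rel 'I_n;
  edge_sym : symmetric edge;
  edge_irr : irreflexive edge;
  nbr : forall v : 'I_n, 'I_(d v) -> 'I_n;
  nbr_inj : forall v, injective (@nbr v);
  edge_nbr : forall v u, edge v u = [exists p, nbr (v := v) p == u]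
}.
Arguments nbr {n d} _ _ _.

Section Answer.
Variables (n : nat) (d : 'I_n -> nat) (G : network d).

Lemma rank_exists (x : port d) :
  exists q : 'I_(d (nbr G (tag x) (tagged x))),
    nbr G (nbr G (tag x) (tagged x)) q == tag x.
Proof.
apply/existsP; rewrite -edge_nbr edge_sym edge_nbr.
by apply/existsP; exists (tagged x).
Qed.

(* (v, p) |-> (u, q), where u = f_v(p) and f_u(q) = v. *)
Definition answer (x : port d) : port d :=
  Tagged (fun v => 'I_(d v)) (xchoose (rank_exists x)).

(* [answer] permutes the set of ports, so that the quantum query
   |v, p> |-> |u, q> is unitary. *)
Lemma answerK : involutive answer.
Proof.
case=> v p; rewrite [answer (existT _ v p)]/answer.
set q := xchoose _; have /eqP/= : nbr G (nbr G v p) q == v.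
  exact: (xchooseP (rank_exists (existT _ v p))).
move: q => q Hq; rewrite /answer.
set p' := xchoose _; have /eqP/= := xchooseP (rank_exists
  (Tagged (fun v => 'I_(d v)) q)).
rewrite -/p'; move: p'; rewrite /= Hq => p' Hp'.
by congr (Tagged _ _); apply: (@nbr_inj _ _ G).
Qed.
End Answer.

(* [None] is the empty symbol; [Some m] is a basis state of a [b]-qubit message. *)
Definition message (b : nat) : finType := option (b.-tuple bool).

(* Basis of the registers of one node with [k] ports: local data and memory [W],
   then the emission registers, then the reception registers. *)
Definition local_config (W : finType) (b k : nat) : finType :=
  (W * {ffun 'I_k -> message b} * {ffun 'I_k -> message b})%type.

(* [X] is the type of local inputs (take [unit] for anonymous nodes without
   input) and [Y] the type of local outputs. In all fields [n] is the number of
   nodes, [k] a degree and [r] a round number: the operation of a node depends on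
   the node only through its degree and the contents of its registers. *)
Record dist_algorithm (R : realType) (X Y : Type) := DistAlgorithm {
  msg_qubits : nat -> nat;
  msg_qubits_log :
    exists a : nat, forall n, (1 < n)%N -> (msg_qubits n <= a * up_log 2 n)%N;
  memory : nat -> nat -> finType;
  memory_init : forall n k, X -> memory n k;
  rounds : nat -> nat;
  local_op : forall n (r : nat) k,
    operator R (local_config (memory n k) (msg_qubits n) k);
  local_op_unitary : forall n r k, unitary (@local_op n r k);
  local_output : forall n k, local_config (memory n k) (msg_qubits n) k -> Y
}.
Arguments local_op {R X Y} _ _ _ _ _ _.
Arguments local_output {R X Y} _ {n k} _.

Section Execution.
Variables (R : realType) (X Y : Type) (A : dist_algorithm R X Y).
Variables (n : nat) (d : 'I_n -> nat).

Definition node_config (v : 'I_n) : finType :=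
  local_config (memory A n (d v)) (msg_qubits A n) (d v).

Definition config : finType := {dffun forall v : 'I_n, node_config v}.

Definition emission (c : config) (x : port d) : message (msg_qubits A n) :=
  (c (tag x)).1.2 (tagged x).

Definition reception (c : config) (x : port d) : message (msg_qubits A n) :=
  (c (tag x)).2 (tagged x).

Definition init_config (inp : 'I_n -> X) : config :=
  [ffun v => (memory_init A n (d v) (inp v), [ffun=> None], [ffun=> None])
     : node_config v].

(* A tensor product. *)
Definition local_step (r : nat) : operator R config :=
  fun c' c => \prod_v local_op A n r (d v) (c' v) (c v).

Definition config_output (c : config) (v : 'I_n) : Y := local_output A (c v).

(* [send] moves the contents of the registers u -> v and v <- u in both
   directions, so every non-empty content it moves is a message sent: were the
   reception registers not counted, information could travel from v to u at no
   cost. The count is the number of non-empty emission registers as soon as the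
   nodes empty their reception registers before [send]. *)
Definition nb_messages (c : config) : nat :=
  #|[set x : port d | emission c x != None]| +
  #|[set x : port d | reception c x != None]|.

Variables (G : network d) (inp : 'I_n -> X).

Definition send (c : config) : config :=
  [ffun v => ((c v).1.1,
              [ffun p : 'I_(d v) => reception c (answer G (existT _ v p))],
              [ffun p : 'I_(d v) => emission c (answer G (existT _ v p))])
     : node_config v].

Fixpoint dist_state (r : nat) : state R config :=
  if r is r'.+1 then
    apply_op (basis_map R send) (apply_op (local_step r') (dist_state r'))
  else basis_state R (init_config inp).

Definition round_message_complexity (r m : nat) : Prop :=
  forall c, apply_op (local_step r) (dist_state r) c != 0 ->
    (nb_messages c <= m)%N.

Definition dist_final_state : state R config := dist_state (rounds A n).
End Execution.

(* The degrees [d] are known to the algorithm. The query register holds either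
   [Some x], with [x] a query, or [None], on which a query acts trivially. *)
Definition central_config (n : nat) (d : 'I_n -> nat) (W : finType) : finType :=
  (option (port d) * W)%type.

Record query_algorithm (R : realType) (n : nat) (d : 'I_n -> nat) (Y : Type) :=
  QueryAlgorithm {
  queries : nat;
  workspace : finType;
  workspace_init : workspace;
  central_op : nat -> operator R (central_config d workspace);
  central_op_unitary : forall i, unitary (central_op i);
  central_output : central_config d workspace -> 'I_n -> Y
}.
Arguments central_op {R n d Y} _ _ _ _.
Arguments central_output {R n d Y} _ _ _.

Section CentralExecution.
Variables (R : realType) (n : nat) (d : 'I_n -> nat) (Y : Type).
Variables (B : query_algorithm R d Y) (G : network d).

Definition query (z : central_config d (workspace B)) :
    central_config d (workspace B) :=
  (omap (answer G) z.1, z.2).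

Fixpoint central_state (i : nat) : state R (central_config d (workspace B)) :=
  apply_op (central_op B i)
    (if i is i'.+1 then apply_op (basis_map R query) (central_state i')
     else basis_state R (None, workspace_init B)).

Definition central_final_state := central_state (queries B).
End CentralExecution.

(* The outputs allowed on each network; port numbers may be mentioned, since a
   node refers to its neighbours through its ports. *)
Definition graph_problem (X Y : Type) :=
  forall (n : nat) (d : 'I_n -> nat),
    network d -> ('I_n -> X) -> pred ('I_n -> Y).

(* Solving a problem means giving an allowed output with probability at least
   [p]. *)
Definition dist_solves (R : realType) (X Y : Type) (p : R)
    (A : dist_algorithm R X Y) (P : graph_problem X Y)
    (n : nat) (d : 'I_n -> nat) (G : network d) (inp : 'I_n -> X) : bool :=
  p%:C <= measure_prob (dist_final_state A G inp)
            (fun c => P n d G inp (config_output c)).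

Definition query_solves (R : realType) (X Y : Type) (p : R)
    (n : nat) (d : 'I_n -> nat) (B : query_algorithm R d Y)
    (P : graph_problem X Y) (G : network d) (inp : 'I_n -> X) : bool :=
  p%:C <= measure_prob (central_final_state B G)
            (fun z => P n d G inp (central_output B z)).

(* Main.v *)
Require Import Defs.
From mathcomp Require Import all_boot all_order all_algebra ring.
From mathcomp Require Import reals complex.
From mathcomp Require Import spectral.

(* The nodes' local operations cost no query, so only [send] has to be simulated,
   with one query per message. Moving the messages one at a time is not
   reversible: once several of them have been delivered, nothing tells which one
   came last. Instead the registers are rewritten in first quantisation: a
   configuration [c] is replaced by the uniform superposition of all arrays of [m]
   slots that list its non-empty registers, in any order and possibly with
   repetitions or empty slots. Applying the query to the port stored in each slot
   is a bijection from the listings of [c] onto those of [send c], hence it maps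
   one uniform superposition to the other. Passing from configurations to listings
   and back does not depend on the network. *)

Set Implicit Arguments.
Unset Strict Implicit.
Unset Printing Implicit Defensive.

Import Order.TTheory GRing.Theory Num.Theory.
Local Open Scope ring_scope.

(** Needed in dependent form because the register space of a node varies with its degree. *)
Lemma bigA_distr_dffun (C : comPzSemiRingType) (I : finType) (T : I -> finType)
    (F : forall i, T i -> C) :
  \prod_i \sum_(t : T i) F i t =
  \sum_(f : {dffun forall i, T i}) \prod_i F i (f i).
Proof.
pose F' i : {ffun T i -> C} := [ffun t => F i t].
(* All the index types are merged into one tagged union, where distributivity over non-dependent
   functions applies; [0] is the value of [untag] off the tag [i] and is never summed. *)
transitivity (\prod_i \sum_(u in tagged_with T i) untag 0 (F' i) u).
  apply: eq_bigr => i _; rewrite -(big_tag (fun i => F' i)).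
  by apply: eq_bigr => t _; rewrite ffunE.
rewrite bigA_distr_big_dep -[LHS](@big_fprod _ _ _ _ _ _ _ F').
rewrite [RHS](reindex _ (onW_bij _ (@dffun_of_fprod_bij _ T))) /=.
by apply: eq_bigr => f _; apply: eq_bigr => i _; rewrite !ffunE.
Qed.

(** * Operators as kernels *)

Section Kernels.
Variables (R : realType) (T : finType).
Implicit Types (U V : operator R T) (psi : state R T).

Lemma unitaryP U :
  reflect (forall y y', \sum_x U y x * (U y' x)^* = (y == y')%:R) (unitary U).
Proof.
apply: (iffP unitarymxP) => [/matrixP UU y y'|UU]; last first.
  apply/matrixP => i j; rewrite !mxE -(inj_eq enum_val_inj) -UU.
  rewrite [RHS](reindex _ (onW_bij _ (enum_val_bij T))).
  by apply: eq_bigr => k _; rewrite !mxE.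
have := UU (enum_rank y) (enum_rank y').
rewrite !mxE (inj_eq enum_rank_inj) => <-.
rewrite [LHS](reindex _ (onW_bij _ (enum_val_bij T))).
by apply: eq_bigr => k _; rewrite !mxE !enum_rankK.
Qed.

Definition comp_op U V : operator R T := fun y x => \sum_z U y z * V z x.

Lemma apply_comp_op U V psi :
  apply_op (comp_op U V) psi = apply_op U (apply_op V psi).
Proof.
apply/ffunP => y; rewrite !ffunE.
under eq_bigr do rewrite mulr_suml.
rewrite exchange_big; apply: eq_bigr => z _; rewrite ffunE mulr_sumr.
by apply: eq_bigr => x _; rewrite mulrA.
Qed.

Lemma eq_apply_op U V : U =2 V -> apply_op U =1 apply_op V.
Proof.
by move=> eqUV psi; apply/ffunP => y; rewrite !ffunE; under eq_bigr do rewrite eqUV.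
Qed.

Lemma sum_delta (x : T) (F : T -> R[i]) : \sum_z (z == x)%:R * F z = F x.
Proof.
rewrite (bigD1 x) //= eqxx mul1r big1 ?addr0 // => z /negPf->.
by rewrite mul0r.
Qed.

Lemma comp_op_unitary U V : unitary U -> unitary V -> unitary (comp_op U V).
Proof.
move=> /unitaryP UU /unitaryP VV; apply/unitaryP => y y'; rewrite -UU.
transitivity (\sum_x \sum_z \sum_z' U y z * (U y' z')^* * (V z x * (V z' x)^*)).
  apply: eq_bigr => x _; rewrite rmorph_sum mulr_suml.
  apply: eq_bigr => z _; rewrite mulr_sumr; apply: eq_bigr => z' _.
  by rewrite rmorphM mulrACA.
rewrite exchange_big; apply: eq_bigr => z _; rewrite exchange_big.
under eq_bigr => z' _ do rewrite -mulr_sumr VV mulrC eq_sym.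
exact: sum_delta.
Qed.

Lemma basis_map_unitary (f : T -> T) : injective f -> unitary (basis_map R f).
Proof.
move=> f_inj; have [g fK gK] := injF_bij f_inj; apply/unitaryP => y y'.
rewrite (eq_bigr (fun x => (x == g y)%:R * (y' == f x)%:R)) => [|x _].
  by rewrite sum_delta gK eq_sym.
by rewrite /basis_map rmorph_nat -{1}[y]gK (inj_eq f_inj) eq_sym.
Qed.

Lemma apply_basis_map (f : T -> T) psi : involutive f ->
  apply_op (basis_map R f) psi = [ffun x => psi (f x)].
Proof.
move=> fK; apply/ffunP => y; rewrite !ffunE -[RHS]sum_delta.
by apply: eq_bigr => x _; rewrite /basis_map eq_sym (can2_eq fK fK).
Qed.

(** * Reflections given by a family of vectors *)

Section Reflection.
Variables (A : finType) (v : A -> T -> R[i]).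
Hypothesis v_real : forall c x, (v c x)^* = v c x.
Hypothesis v_gram :
  forall c x, \sum_c' (\sum_z v c z * v c' z) * v c' x = 2%:R * v c x.

(* [1 - V V^*], where [V] has columns [v c]; it is an involution as soon as
   [V V^* V = 2 V]. *)
Definition reflection : operator R T :=
  fun y x => (y == x)%:R - \sum_c v c y * v c x.

Lemma apply_reflection psi x :
  apply_op reflection psi x = psi x - \sum_c (\sum_z v c z * psi z) * v c x.
Proof.
rewrite ffunE; under eq_bigr do rewrite mulrBl.
rewrite sumrB; congr (_ - _).
  by under eq_bigr do rewrite eq_sym; rewrite sum_delta.
under eq_bigr do rewrite mulr_suml.
rewrite exchange_big; apply: eq_bigr => c _; rewrite mulr_suml.
by apply: eq_bigr => z _; ring.
Qed.

Lemma reflectionK : involutive (apply_op reflection).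
Proof.
move=> psi; apply/ffunP => x; rewrite !apply_reflection.
pose a c : R[i] := \sum_z v c z * psi z.
(* The coefficients of [psi] along the [v c] change sign under the reflection, since
   [V^* V V^* = 2 V^*]; the second application therefore adds back what the first one subtracted. *)
have aE c : \sum_z v c z * apply_op reflection psi z = - a c.
  under eq_bigr do rewrite apply_reflection mulrBr.
  rewrite sumrB -/(a c).
  suff -> : \sum_z v c z * (\sum_c' a c' * v c' z) = 2%:R * a c by ring.
  transitivity (\sum_z \sum_c' (\sum_x v c x * v c' x) * v c' z * psi z).
    under eq_bigr do rewrite mulr_sumr.
    rewrite exchange_big [RHS]exchange_big; apply: eq_bigr => c' _.
    under eq_bigr do rewrite mulrCA.
    under [RHS]eq_bigr do rewrite -mulrA.
    by rewrite -!mulr_sumr mulrC.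
  rewrite mulr_sumr; apply: eq_bigr => z _.
  by rewrite -mulr_suml v_gram mulrA.
rewrite [X in _ - X](eq_bigr (fun c => - (a c * v c x))) => [|c _].
  by rewrite sumrN opprK subrK.
by rewrite aE mulNr.
Qed.

(** The kernel is real and symmetric, hence its own adjoint, and it is an involution. *)
Lemma reflection_unitary : unitary reflection.
Proof.
have refl_sym y x : reflection y x = reflection x y.
  by rewrite /reflection eq_sym; under eq_bigr do rewrite mulrC.
have refl_real y x : (reflection y x)^* = reflection y x.
  rewrite rmorphB rmorph_nat rmorph_sum; congr (_ - _).
  by apply: eq_bigr => c _; rewrite rmorphM /= !v_real.
apply/unitaryP => y y'.
have /ffunP/(_ y) := reflectionK (basis_state R y'); rewrite !ffunE => <-.
apply: eq_bigr => x _; rewrite refl_real refl_sym ffunE.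
congr (_ * _); under eq_bigr do rewrite ffunE mulrC.
by rewrite sum_delta.
Qed.
End Reflection.
End Kernels.

Section Registers.
Variables (R : realType) (P A B : finType).
Local Notation T := (option P * (A + B))%type.

(** [A] will hold configurations and [B] listings; between simulated steps the query register is
    back to [None]. *)
Definition embed_state (psi : state R A) (chi : state R B) : state R T :=
  [ffun z => if z.1 is Some _ then 0
             else match z.2 with inl a => psi a | inr b => chi b end].

Lemma sum_embed (F : T -> R[i]) : (forall p w, F (Some p, w) = 0) ->
  \sum_z F z = \sum_a F (None, inl a) + \sum_b F (None, inr b).
Proof.
move=> F0; rewrite (eq_bigr (fun z => F (z.1, z.2))); last by case.
rewrite -(pair_bigA _ (fun q w => F (q, w))) (bigD1 None) //= [X in _ + X]big1.
  by rewrite addr0 big_sumType.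
by case=> [p|//] _; apply: big1.
Qed.

Lemma embed_basis_state a :
  embed_state (basis_state R a) [ffun=> 0] = basis_state R (None, inl a).
Proof.
by apply/ffunP => -[[p|] [a'|b]]; rewrite !ffunE ?xpair_eqE /= ?ffunE ?andbF.
Qed.

(** The direct sum of [U] and the identity of [B], tensored with the identity of the query
    register. *)
Definition extend_op (U : operator R A) : operator R T :=
  fun y x => match y.2, x.2 with
             | inl a', inl a => (y.1 == x.1)%:R * U a' a
             | inr b', inr b => (y.1 == x.1)%:R * (b' == b)%:R
             | _, _ => 0
             end.

Lemma extend_op_unitary U : unitary U -> unitary (extend_op U).
Proof.
move=> /unitaryP UU; apply/unitaryP => -[q w] [q' w'].
rewrite (eq_bigr (fun z => extend_op U (q, w) (z.1, z.2) *
  (extend_op U (q', w') (z.1, z.2))^*)); last by case.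
rewrite -(pair_bigA _ (fun p u => extend_op U (q, w) (p, u) *
  (extend_op U (q', w') (p, u))^*)) /=.
transitivity (\sum_p (p == q)%:R * ((q' == p)%:R * (w == w')%:R : R[i])).
  apply: eq_bigr => p _; rewrite big_sumType mulrA -natrM mulnb eq_sym.
  rewrite /extend_op /=; case: w w' => [a|b] [a'|b'].
  - rewrite [X in _ + X]big1 ?addr0 => [|b _]; last by rewrite mul0r.
    rewrite -UU mulr_sumr; apply: eq_bigr => x _.
    by rewrite rmorphM rmorph_nat -mulnb natrM mulrACA.
  - by rewrite !big1 ?addr0 ?mulr0 // => x _; rewrite ?mul0r ?rmorph0 ?mulr0.
  - by rewrite !big1 ?addr0 ?mulr0 // => x _; rewrite ?mul0r ?rmorph0 ?mulr0.
  - rewrite [X in X + _]big1 ?add0r => [|x _]; last by rewrite mul0r.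
    rewrite -[X in _ = _ * X](sum_delta b (fun x => (x == b')%:R)).
    rewrite mulr_sumr; apply: eq_bigr => x _.
    by rewrite rmorphM !rmorph_nat -mulnb natrM mulrACA ![x == _]eq_sym.
by rewrite sum_delta -natrM mulnb xpair_eqE [q' == q]eq_sym.
Qed.

Lemma apply_extend_op U psi :
  apply_op (extend_op U) (embed_state psi [ffun=> 0]) =
  embed_state (apply_op U psi) [ffun=> 0].
Proof.
apply/ffunP => -[q w]; rewrite !ffunE sum_embed => [|p u]; last first.
  by rewrite ffunE mulr0.
rewrite [X in _ + X]big1 => [|b _]; last by rewrite ffunE /= ffunE mulr0.
rewrite addr0 /extend_op /=; case: q w => [p|] [a|b] /=.
- by apply: big1 => x _; rewrite mul0r mul0r.
- by apply: big1 => x _; rewrite mul0r.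
- by rewrite ffunE; apply: eq_bigr => x _; rewrite ffunE mul1r.
- by rewrite ffunE; apply: big1 => x _; rewrite mul0r.
Qed.

(** * Exchanging basis states with uniform superpositions *)

Section Encoding.
Variable F : A -> {set B}.
Hypothesis F_disjoint : forall a a' b, b \in F a -> b \in F a' -> a = a'.

(** Amplitudes of the normalised uniform superposition of [F a], or the zero vector if [F a] is
    empty. *)
Definition code (a : A) (b : B) : R[i] :=
  (b \in F a)%:R * (sqrtC #|F a|%:R)^-1.

Lemma code_dot a a' :
  \sum_b code a b * code a' b = ((F a != set0) && (a == a'))%:R.
Proof.
have [<-|neq] := eqVneq a a'; last first.
  rewrite andbF big1 // => b _; rewrite /code.
  case: (boolP (b \in F a)) => [ba|]; last by rewrite !mul0r.
  case: (boolP (b \in F a')) => [ba'|]; last by rewrite mul0r mulr0.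
  by case/eqP: neq; apply: F_disjoint ba ba'.
rewrite andbT (eq_bigr (fun b => (b \in F a)%:R * #|F a|%:R^-1)); last first.
  move=> b _; rewrite /code mulrACA -natrM mulnb andbb -invfM -expr2.
  by rewrite sqrtCK.
rewrite -mulr_suml.
have -> : \sum_b (b \in F a)%:R = #|F a|%:R :> R[i].
  rewrite -sum1_card natr_sum [RHS]big_mkcond.
  by apply: eq_bigr => b _; case: (b \in F a).
have [->|Fa] := eqVneq (F a) set0; first by rewrite cards0 mul0r.
by rewrite mulfV // pnatr_eq0 cards_eq0.
Qed.

(** The difference of two orthogonal unit vectors, [inl a] and the code of [a]: it has squared norm
    2, so [1 - V V^*] exchanges the two. It vanishes when [F a] is empty. *)
Definition code_diff (a : A) (z : T) : R[i] :=
  if z.1 is Some _ then 0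
  else match z.2 with
       | inl a' => ((F a != set0) && (a' == a))%:R
       | inr b => - code a b
       end.

(* The reflection exchanging the basis state [inl a] and the uniform superposition
   of [F a], for every [a] with [F a] non-empty. *)
Definition encode_op : operator R T := reflection code_diff.

Lemma code_diff_real a z : (code_diff a z)^* = code_diff a z.
Proof.
case: z => [[p|] [a'|b]]; rewrite /code_diff /= ?rmorph0 ?rmorph_nat //.
rewrite rmorphN rmorphM rmorph_nat fmorphV /=.
by rewrite (geC0_conj (_ : 0 <= sqrtC _)) // sqrtC_ge0.
Qed.

(** Disjointness of the sets [F a] makes these vectors pairwise orthogonal, with squared norm 2 or
    0. *)
Lemma code_diff_gram a z :
  \sum_a' (\sum_x code_diff a x * code_diff a' x) * code_diff a' z =
  2%:R * code_diff a z.
Proof.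
have diff0 : (F a != set0)%:R * code_diff a z = code_diff a z.
  have [Fa0|_] := eqVneq (F a) set0; last by rewrite mul1r.
  rewrite mul0r; case: z => [[p|] [a'|b]]; rewrite /code_diff //= ?Fa0 ?eqxx //.
  by rewrite /code Fa0 inE mul0r oppr0.
transitivity (\sum_a' (a' == a)%:R * (2%:R * ((F a != set0)%:R * code_diff a' z))).
  apply: eq_bigr => a' _; rewrite sum_embed => [|p w]; last first.
    by rewrite /code_diff mul0r.
  rewrite /code_diff /=.
  under [X in _ + X]eq_bigr do rewrite mulrNN.
  rewrite code_dot (eq_bigr (fun x => (x == a)%:R *
     ((F a != set0)%:R * ((F a' != set0) && (x == a'))%:R))); last first.
    by move=> x _; rewrite andbC -mulnb natrM mulrA.
  rewrite sum_delta [a' == a]eq_sym; case: (eqVneq a a') => [<-|_].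
    by rewrite !andbT -natrM mulnb andbb -mulr2n -[_ *+ 2]mulr_natl mul1r mulrA.
  by rewrite !andbF mulr0 addr0 !mul0r.
by rewrite sum_delta diff0.
Qed.

Lemma encode_op_unitary : unitary encode_op.
Proof. exact: reflection_unitary code_diff_real code_diff_gram. Qed.

Lemma encode_opK : involutive (apply_op encode_op).
Proof. exact: reflectionK code_diff_gram. Qed.

(** The overlap with [code_diff a] is [psi a], so the reflection removes [psi a] from [inl a] and
    puts it on the code of [a]. An [a] with empty [F a] would be left in place, hence the condition
    on the support. *)
Lemma encode_embed (psi : state R A) :
  (forall a, psi a != 0 -> F a != set0) ->
  apply_op encode_op (embed_state psi [ffun=> 0]) =
  embed_state [ffun=> 0] [ffun b => \sum_a psi a * code a b].
Proof.
move=> psiF; apply/ffunP => z; rewrite apply_reflection.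
rewrite (eq_bigr (fun a => psi a * code_diff a z)) => [|a _]; last first.
  congr (_ * _); rewrite sum_embed => [|p w]; last by rewrite ffunE mulr0.
  rewrite [X in _ + X]big1 => [|b _]; last by rewrite ffunE /= ffunE mulr0.
  rewrite addr0 -[RHS]sum_delta; apply: eq_bigr => x _.
  rewrite ffunE /code_diff /=; case: (eqVneq x a) => [->|_]; last by rewrite andbF.
  rewrite andbT; by have [->|/psiF->] := eqVneq (psi a) 0; rewrite ?mulr0.
rewrite !ffunE; case: z => [[p|] [a|b]]; rewrite /code_diff /=.
- by rewrite big1 ?subr0 // => x _; rewrite mulr0.
- by rewrite big1 ?subr0 // => x _; rewrite mulr0.
- rewrite ffunE (eq_bigr (fun x => (x == a)%:R * psi x)) ?sum_delta ?subrr //.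
  move=> x _; rewrite mulrC [a == x]eq_sym; have [->|/psiF->//] := eqVneq (psi x) 0.
  by rewrite !mulr0.
- by rewrite !ffunE sub0r -sumrN; apply: eq_bigr => x _; rewrite mulrN opprK.
Qed.
End Encoding.
End Registers.

(** * States reachable with a given number of queries *)

Section Simulation.
Variables (R : realType) (n : nat) (d : 'I_n -> nat) (Y : Type).
Variables (W : finType) (w0 : W) (out : central_config d W -> 'I_n -> Y).

Definition algorithm_of (q : nat) (ops : nat -> operator R (central_config d W))
    (opsU : forall i, unitary (ops i)) : query_algorithm R d Y :=
  QueryAlgorithm q w0 opsU out.

(** The operators are quantified before [G]: a single algorithm must serve every network satisfying
    [H]. *)
Definition simulable (H : network d -> Prop) (q : nat)
    (psi : network d -> state R (central_config d W)) : Prop :=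
  exists ops (opsU : forall i, unitary (ops i)),
    forall G, H G -> central_state (algorithm_of q opsU) G q = psi G.

Lemma eq_central_state q q' ops ops' (opsU : forall i, unitary (ops i))
    (opsU' : forall i, unitary (ops' i)) G k :
  (forall i, (i <= k)%N -> ops i =2 ops' i) ->
  central_state (algorithm_of q opsU) G k =
  central_state (algorithm_of q' opsU') G k.
Proof.
elim: k => [|k IHk] eq_ops /=.
  exact: (eq_apply_op (eq_ops 0%N (leqnn _))).
rewrite IHk => [|i ik]; last by apply: eq_ops; apply: leqW.
exact: (eq_apply_op (eq_ops k.+1 (leqnn _))).
Qed.

Lemma id_unitary (T : finType) : unitary (basis_map R (@id T)).
Proof. exact: basis_map_unitary. Qed.

Lemma apply_id (T : finType) (psi : state R T) : apply_op (basis_map R id) psi = psi.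
Proof. by apply/ffunP => x; rewrite apply_basis_map // ffunE. Qed.

Variable H : network d -> Prop.
Implicit Types psi : network d -> state R (central_config d W).

Lemma eq_simulable q psi psi' : (forall G, H G -> psi G = psi' G) ->
  simulable H q psi -> simulable H q psi'.
Proof.
move=> eq_psi [ops [opsU Hpsi]]; exists ops, opsU => G HG.
by rewrite Hpsi ?eq_psi.
Qed.

Lemma simulable_init : simulable H 0 (fun=> basis_state R (None, w0)).
Proof.
exists (fun=> basis_map R id), (fun=> id_unitary _) => G _ /=.
exact: apply_id.
Qed.

(** A network-independent unitary is absorbed into the operator that follows the last query, so it
    is free. *)
Lemma simulable_unitary q psi U : unitary U -> simulable H q psi ->
  simulable H q (fun G => apply_op U (psi G)).
Proof.
move=> UU [ops [opsU Hpsi]].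
pose ops' i := if i == q then comp_op U (ops q) else ops i.
have ops'U i : unitary (ops' i).
  by rewrite /ops'; case: eqP => // _; apply: comp_op_unitary.
exists ops', ops'U => G HG; rewrite -(Hpsi G HG).
have ops'q : ops' q =2 comp_op U (ops q) by move=> y x; rewrite /ops' eqxx.
have ops'lt i : (i < q)%N -> ops' i =2 ops i.
  by move=> iq y x; rewrite /ops' ltn_eqF.
move: ops' ops'U ops'q ops'lt {Hpsi}.
case: q => [|q] ops' ops'U ops'q ops'lt /=;
  rewrite (eq_apply_op ops'q) apply_comp_op //.
by congr (apply_op _ (apply_op _ (apply_op _ _))); apply: eq_central_state.
Qed.

Lemma simulable_query q psi : simulable H q psi ->
  simulable H q.+1 (fun G => apply_op
    (basis_map R (fun z : central_config d W => (omap (answer G) z.1, z.2)))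
    (psi G)).
Proof.
move=> [ops [opsU Hpsi]].
pose ops' i := if i == q.+1 then basis_map R id else ops i.
have ops'U i : unitary (ops' i).
  by rewrite /ops'; case: eqP => // _; apply: id_unitary.
exists ops', ops'U => G HG; rewrite -(Hpsi G HG) /=.
rewrite {1}/ops' eqxx apply_id; congr apply_op.
apply: eq_central_state => i iq y x.
by rewrite /ops' ltn_eqF.
Qed.
End Simulation.

(** * Configurations of the distributed network *)

Section Routing.
Variables (R : realType) (X Y : Type) (A : dist_algorithm R X Y).
Variables (n : nat) (d : 'I_n -> nat).

(** Inner products of rows of a tensor product factor over the nodes; one node where [c] and [c']
    differ makes the product vanish. *)
Lemma local_step_unitary r : unitary (@local_step R X Y A n d r).
Proof.
apply/unitaryP => c c'.
rewrite (eq_bigr (fun x : config A d => \prod_v (local_op A n r (d v) (c v) (x v) *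
  (local_op A n r (d v) (c' v) (x v))^*))) => [|x _]; last first.
  by rewrite /local_step rmorph_prod -big_split.
rewrite -(bigA_distr_dffun (fun v (t : node_config A d v) =>
  local_op A n r (d v) (c v) t * (local_op A n r (d v) (c' v) t)^*)).
under eq_bigr do rewrite (unitaryP _ (local_op_unitary A n r _)).
have [->|/eqP neq] := eqVneq c c'; first by rewrite big1 // => v _; rewrite eqxx.
have [/forallP eqc|] := boolP [forall v, c v == c' v].
  by case: neq; apply/ffunP => v; apply/eqP.
by case/forallPn => v /negPf neqv; rewrite (bigD1 v) //= neqv mul0r.
Qed.

Definition register (c : config A d) (x : port d) (k : bool) :=
  if k then emission c x else reception c x.

Definition memories : finType := {dffun forall v, memory A n (d v)}.

Definition contents (c : config A d) : memories := [ffun v => (c v).1.1].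

Lemma config_ext c c' : contents c = contents c' ->
  (forall x k, register c x k = register c' x k) -> c = c'.
Proof.
move=> /ffunP eq_mem eq_reg; apply/ffunP => v.
have:= eq_mem v; rewrite !ffunE.
have : (c v).1.2 = (c' v).1.2.
  by apply/ffunP => p; apply: (eq_reg (existT _ v p) true).
have : (c v).2 = (c' v).2.
  by apply/ffunP => p; apply: (eq_reg (existT _ v p) false).
by case: (c v) (c' v) => [[w e] r] [[w' e'] r'] /= -> -> ->.
Qed.

Lemma register_send G c x k :
  register (send G c) x k = register c (answer G x) (~~ k).
Proof.
by case: x k => v p [] /=; rewrite /register /emission /reception /= ffunE ffunE.
Qed.

Lemma contents_send G c : contents (send G c) = contents c.
Proof. by apply/ffunP => v; rewrite !ffunE. Qed.

Lemma sendK G : involutive (@send R X Y A n d G).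
Proof.
move=> c; apply: config_ext => [|x k]; first by rewrite !contents_send.
by rewrite !register_send answerK negbK.
Qed.

(** * Listings of a configuration *)

Variable N : nat.

(* The boolean tells emission registers ([true]) from reception registers. *)
Local Notation letter := (bool * (msg_qubits A n).-tuple bool)%type.
Local Notation slot := (option (port d) * letter)%type.
Local Notation listing := (memories * {ffun 'I_N -> slot})%type.

(* Only the first [m] slots may be used, so that [m] queries move all messages. *)
Definition listings (m : nat) (c : config A d) : {set listing} :=
  [set e : listing | [&& e.1 == contents c,
               [forall j : 'I_N, (m <= j)%N ==> ((e.2 j).1 == None)] &
               [forall x, forall k, forall s, (register c x k == Some s) ==
                  [exists j, e.2 j == (Some x, (k, s))]]]].

Lemma listingsP m c (e : listing) :
  reflect [/\ e.1 = contents c,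
              forall j : 'I_N, (m <= j)%N -> (e.2 j).1 = None &
              forall x k s, (register c x k == Some s) =
                            [exists j, e.2 j == (Some x, (k, s))]]
          (e \in listings m c).
Proof.
rewrite inE; apply: (iffP and3P) => -[].
  move=> /eqP ? /forallP Hj /forallP Hx; split=> // [j mj|x k s].
    by have /implyP/(_ mj)/eqP := Hj j.
  by have /forallP/(_ k)/forallP/(_ s)/eqP := Hx x.
move=> -> Hj Hx; split=> //.
  by apply/forallP => j; apply/implyP => /Hj ->.
apply/forallP => x; apply/forallP => k; apply/forallP => s.
by rewrite Hx.
Qed.

(** A listing determines its configuration: it carries the memories and every non-empty register,
    and an unlisted register is empty. *)
Lemma listings_disjoint m c c' e  :
  e \in listings m c -> e \in listings m c' -> c = c'.
Proof.
move=> /listingsP[ec _ Hc] /listingsP[ec' _ Hc'].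
apply: config_ext => [|x k]; first by rewrite -ec.
case Ec: (register c x k) => [s|].
  by apply/esym/eqP; rewrite Hc' -Hc Ec.
case Ec': (register c' x k) => [s|//].
by have := Hc' x k s; rewrite -Hc Ec Ec' eqxx.
Qed.

Lemma listings_neq0 m c : (m <= N)%N -> (nb_messages c <= m)%N ->
  listings m c != set0.
Proof.
move=> mN cm.
pose L := [seq (x, true) | x <- enum [set x | emission c x != None]] ++
          [seq (x, false) | x <- enum [set x | reception c x != None]].
have sizeL : (size L <= m)%N by rewrite size_cat !size_map -!cardE.
have memL x k : ((x, k) \in L) = (register c x k != None).
  rewrite mem_cat; case: k.
    rewrite mem_map ?mem_enum ?inE => [|y z [] //].
    by rewrite [X in _ || X](introF mapP) ?orbF // => -[].
  rewrite [X in X || _](introF mapP) => [|[]//].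
  by rewrite mem_map ?mem_enum ?inE // => y z [].
(* An arbitrary letter to fill the slots without a port. *)
pose s0 : letter := (true, [tuple false | _ < msg_qubits A n]).
pose entry (o : option (port d * bool)) : slot :=
  if o is Some (x, k) then
    if register c x k is Some s then (Some x, (k, s)) else (None, s0)
  else (None, s0).
apply/set0Pn; exists (contents c, [ffun j : 'I_N => entry (onth L j)]).
apply/listingsP; split=> //= [j mj|x k s].
  by rewrite ffunE onth_default // (leq_trans sizeL).
apply/eqP/existsP => [Ec|[j]].
  have xL : (x, k) \in L by rewrite memL Ec.
  have jN : (index (x, k) L < N)%N.
    by rewrite (leq_trans _ mN) // (leq_trans _ sizeL) // index_mem.
  exists (Ordinal jN); rewrite ffunE /=.
  by rewrite onthE (nth_map (x, k)) ?index_mem // nth_index //= Ec.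
rewrite ffunE; case: (onth L j) => [[y k']|] //=.
by case Ec: (register c y k') => [s'|] //= /eqP[<- <- <-].
Qed.

(** * The action of [send] on listings *)

Section Route.
Variable G : network d.

Definition route (m : nat) (e : listing) : listing :=
  (e.1, [ffun j : 'I_N => if (j < m)%N then (omap (answer G) (e.2 j).1, (e.2 j).2)
                          else e.2 j]).

(** [send] turns emission registers into reception registers and conversely. *)
Definition flip (e : listing) : listing :=
  (e.1, [ffun j => ((e.2 j).1, (~~ (e.2 j).2.1, (e.2 j).2.2))]).

Lemma flipK : involutive flip.
Proof.
case=> w t; congr pair; apply/ffunP => j; rewrite !ffunE /= negbK.
by case: (t j) => ? [].
Qed.

Lemma omap_answerK : involutive (omap (answer G)).
Proof. by case=> //= x; rewrite answerK. Qed.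

Lemma routeK m : involutive (route m).
Proof.
case=> w t; congr pair; apply/ffunP => j; rewrite !ffunE /=.
by case: (j < m)%N; case: (t j) => [[x|] l] //=; rewrite answerK.
Qed.

(** [send] moves the register of kind [k] at [x] to kind [~~ k] at [answer G x], which is what
    routing and flipping do to each slot. Slots from [m] on hold no port, so leaving them unrouted
    is harmless. *)
Lemma listings_send m c (e : listing) :
  (route m (flip e) \in listings m c) = (e \in listings m (send G c)).
Proof.
have routeE (j : 'I_N) x k s : ((m <= j)%N -> (e.2 j).1 = None) ->
    ((route m (flip e)).2 j == (Some x, (k, s))) =
    (e.2 j == (Some (answer G x), (~~ k, s))).
  rewrite !ffunE /= => Hj; case: ltnP => [_|/Hj]; case: (e.2 j) => [o [k' s']] /=.
    rewrite !xpair_eqE (can2_eq omap_answerK omap_answerK) /=.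
    by rewrite (can2_eq negbK negbK).
  by move=> ->.
have noneE : (forall j : 'I_N, (m <= j)%N -> ((route m (flip e)).2 j).1 = None) <->
             (forall j : 'I_N, (m <= j)%N -> (e.2 j).1 = None).
  by split=> Hj j mj; move: (Hj j mj); rewrite !ffunE ltnNge mj.
apply/listingsP/listingsP => -[He Hj Hx]; split; rewrite ?contents_send //.
- exact/noneE.
- move=> x k s; rewrite register_send Hx; apply: eq_existsb => j.
  by rewrite routeE ?answerK ?negbK //; apply/noneE: (j).
- by rewrite -(contents_send G).
- exact/noneE.
- move=> x k s; rewrite -{1}[x](answerK G) -{1}[k]negbK -register_send Hx.
  by apply: eq_existsb => j; rewrite routeE // => /Hj.
Qed.

(** The bijection preserves the number of listings, hence the normalising factor of the code. *)
Lemma card_listings_send m c : #|listings m (send G c)| = #|listings m c|.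
Proof.
rewrite -[RHS](card_imset _ (inv_inj (routeK m))).
rewrite -[RHS](card_imset _ (inv_inj flipK)); congr #|pred_of_set _|.
apply/setP => e; rewrite -listings_send.
rewrite -[X in _ = (X \in _)]flipK mem_imset; last exact: inv_inj flipK.
by rewrite -[X in _ = (X \in _)](routeK m) mem_imset //; apply: inv_inj (routeK m).
Qed.

Lemma sum_code_route m (psi : state R (config A d)) (e : listing) :
  \sum_c psi c * code R (listings m) c (route m (flip e)) =
  \sum_c apply_op (basis_map R (send G)) psi c * code R (listings m) c e.
Proof.
rewrite [RHS](reindex_inj (inv_inj (sendK G))); apply: eq_bigr => c _.
rewrite (apply_basis_map _ (sendK G)) ffunE sendK /code listings_send.
by rewrite card_listings_send.
Qed.
End Route.
End Routing.

(** * Simulation of the rounds *)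

Section Rounds.
Variables (R : realType) (X Y : Type) (A : dist_algorithm R X Y).
Variables (n : nat) (d : 'I_n -> nat) (inp : 'I_n -> X) (N : nat).

Local Notation letter := (bool * (msg_qubits A n).-tuple bool)%type.
Local Notation slot := (option (port d) * letter)%type.
Local Notation listing := (memories A d * {ffun 'I_N -> slot})%type.
Local Notation W := (config A d + listing)%type.

Definition swap_slot (j : 'I_N) (z : central_config d W) : central_config d W :=
  match z.2 with
  | inl _ => z
  | inr e => ((e.2 j).1,
      inr (e.1, [ffun i => if i == j then (z.1, (e.2 j).2) else e.2 i]))
  end.

Lemma swap_slotK j : involutive (swap_slot j).
Proof.
case=> q [c|[w t]] //=; rewrite /swap_slot /= ffunE eqxx /=.
congr (_, inr (_, _)); apply/ffunP => i; rewrite !ffunE.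
by case: eqVneq => [->|//]; rewrite -surjective_pairing.
Qed.

Definition flip_slots (z : central_config d W) : central_config d W :=
  (z.1, match z.2 with inl c => inl c | inr e => inr (flip e) end).

Lemma flip_slotsK : involutive flip_slots.
Proof. by case=> q [c|e] //=; rewrite /flip_slots /= flipK. Qed.

Variables (w0 : W) (out : central_config d W -> 'I_n -> Y).
Variable H : network d -> Prop.
Implicit Type chi : network d -> state R listing.

Lemma simulable_route k q chi : (k <= N)%N ->
  simulable w0 out H q (fun G => embed_state (port d) [ffun=> 0] (chi G)) ->
  simulable w0 out H (q + k) (fun G =>
    embed_state (port d) [ffun=> 0] [ffun e => chi G (route G k e)]).
Proof.
move=> kN sim; elim: k kN => [|k IHk] kN.
  rewrite addn0; apply: eq_simulable sim => G _; congr embed_state.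
  apply/ffunP => -[w t]; rewrite ffunE; congr (chi G (_, _)).
  by apply/ffunP => j; rewrite ffunE.
(* The port of slot [k] is swapped into the query register, queried, and swapped back, which leaves
   [None] in the register again. *)
pose j := Ordinal kN; have swapU := basis_map_unitary R (inv_inj (swap_slotK j)).
have := simulable_unitary swapU (IHk (ltnW kN)).
move=> /simulable_query/(simulable_unitary swapU); rewrite addnS.
apply: eq_simulable => G _.
have queryK : involutive
    (fun z : central_config d W => (omap (answer G) z.1, z.2)).
  by case=> [[x|] w] //=; rewrite answerK.
rewrite !apply_basis_map //; try exact: swap_slotK.
apply/ffunP => -[q' [c|[w t]]]; rewrite !ffunE /=.
  by case: q' => [x|] /=; rewrite ?ffunE.
rewrite /swap_slot /= ffunE eqxx; case: q' => [x|] //=.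
rewrite !ffunE; congr (chi G (_, _)); apply/ffunP => i; rewrite !ffunE /=.
rewrite ltnS [(i <= k)%N]leq_eqVlt (_ : (i == k :> nat) = (i == j)) //.
by case: (eqVneq i j) => [->|_] /=; rewrite ?ltnn.
Qed.

(** Encode, route the first [m] slots at one query each, flip, decode. The message bound gives every
    configuration of the support a listing. *)
Lemma simulable_send m q (psi : network d -> state R (config A d)) :
  (m <= N)%N ->
  (forall G, H G -> forall c, psi G c != 0 -> (nb_messages c <= m)%N) ->
  simulable w0 out H q (fun G => embed_state (port d) (psi G) [ffun=> 0]) ->
  simulable w0 out H (q + m) (fun G =>
    embed_state (port d) (apply_op (basis_map R (send G)) (psi G)) [ffun=> 0]).
Proof.
move=> mN psi_m sim.
have disj := @listings_disjoint R X Y A n d N m.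
have encU := encode_op_unitary R (port d) disj.
pose chi G : state R listing :=
  [ffun e => \sum_c psi G c * code R (listings N m) c e].
have psi0 G (HG : H G) c : psi G c != 0 -> listings N m c != set0.
  by move=> /(psi_m G HG); apply: listings_neq0.
have /(simulable_route mN) : simulable w0 out H q (fun G =>
    embed_state (port d) [ffun=> 0] (chi G)).
  apply: eq_simulable (simulable_unitary encU sim) => G HG.
  by rewrite encode_embed //; apply: psi0.
move=> /(simulable_unitary (basis_map_unitary R (inv_inj flip_slotsK))).
move=> /(simulable_unitary encU); apply: eq_simulable => G HG.
(* Encoding is its own inverse, so it is enough to compare the encoded states. *)
rewrite -[RHS](encode_opK disj) encode_embed => [|c]; last first.
  rewrite (apply_basis_map _ (sendK G)) ffunE => /(psi0 G HG).
  by rewrite -!card_gt0 card_listings_send.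
congr apply_op; rewrite (apply_basis_map _ flip_slotsK).
apply/ffunP => -[[x|] [c|e]]; rewrite !ffunE //=; try by rewrite !ffunE.
by rewrite !ffunE sum_code_route.
Qed.

Lemma simulable_rounds (m : nat -> nat) k : (k <= rounds A n)%N ->
  (forall r, (r < k)%N -> (m r <= N)%N) ->
  (forall G, H G -> forall r, (r < k)%N ->
     round_message_complexity A G inp r (m r)) ->
  w0 = inl (init_config A d inp) ->
  simulable w0 out H (\sum_(r < k) m r)%N (fun G =>
    embed_state (port d) (dist_state A G inp k) [ffun=> 0]).
Proof.
move=> kr mN Hm w0E; elim: k kr mN Hm => [|k IHk] kr mN Hm.
  rewrite big_ord0; apply: eq_simulable (simulable_init _ _ _ _) => G _.
  by rewrite embed_basis_state w0E.
rewrite big_ord_recr /=.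
have /(simulable_unitary (extend_op_unitary (port d) _
   (local_step_unitary A d k))) := IHk (ltnW kr)
  (fun r rk => mN r (leqW rk)) (fun G HG r rk => Hm G HG r (leqW rk)).
move=> sim; apply: simulable_send; first exact: mN.
  by move=> G HG c; apply: Hm.
by apply: eq_simulable sim => G _; rewrite apply_extend_op.
Qed.
End Rounds.

Theorem lemma7p3 (R : realType) (X Y : Type)
    (A : dist_algorithm R X Y) (P : graph_problem X Y) (p : R)
    (n : nat) (d : 'I_n -> nat) (inp : 'I_n -> X)
    (m : 'I_(rounds A n) -> nat) (M : nat)
    (hM : M = (\sum_(r < rounds A n) m r)%N) :
  exists B : query_algorithm R d Y,
    queries B = M /\
    forall G : network d,
      dist_solves p A P G inp ->
      (forall r : 'I_(rounds A n), round_message_complexity A G inp r (m r)) ->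
      query_solves p B P G inp.
Proof.
(* Extends [m] by 0 to all round numbers. *)
pose m' r := oapp m 0%N (insub r).
have m'E (r : 'I_(rounds A n)) : m' r = m r by rewrite /m' valK.
pose c0 := init_config A d inp.
(* Each [m r] is at most [M], so arrays of [M] slots serve every round. *)
pose W : finType := (config A d + memories A d * {ffun 'I_M ->
  option (port d) * (bool * (msg_qubits A n).-tuple bool)})%type.
(* The default [c0] is for the listing side, which has zero amplitude in the final state when [G]
   satisfies [H]. *)
pose out (z : central_config d W) :=
  config_output (if z.2 is inl c then c else c0).
pose H (G : network d) :=
  forall r : 'I_(rounds A n), round_message_complexity A G inp r (m r).
have m'_le r : (r < rounds A n)%N -> (m' r <= M)%N.
  move=> rn; rewrite -[r]/(val (Ordinal rn)) m'E hM.
  by rewrite (bigD1 (Ordinal rn)) ?leq_addr.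
have Hm' G : H G -> forall r, (r < rounds A n)%N ->
    round_message_complexity A G inp r (m' r).
  by move=> HG r rn; have := HG (Ordinal rn); rewrite -m'E.
have sum_m' : (\sum_(r < rounds A n) m' r)%N = M.
  by rewrite hM; apply: eq_bigr => r _; apply: m'E.
have := simulable_rounds out (leqnn _) m'_le Hm' (erefl (inl c0 : W)).
rewrite sum_m' => -[ops [opsU sim]].
exists (algorithm_of (inl c0) out M opsU); split=> // G solves HG.
suff eq_prob :
  measure_prob (central_final_state (algorithm_of (inl c0) out M opsU) G)
    (fun z => P n d G inp (out z)) =
  measure_prob (dist_final_state A G inp)
    (fun c => P n d G inp (config_output c)).
  by rewrite /query_solves [X in _ <= X]eq_prob.
have -> : central_final_state (algorithm_of (inl c0) out M opsU) G =
    embed_state (port d) (dist_final_state A G inp) [ffun=> 0].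
  exact: sim.
rewrite /measure_prob big_mkcond sum_embed => [|x w]; last first.
  by rewrite ffunE normr0 expr0n if_same.
rewrite [X in _ + X]big1 ?addr0 => [|e _]; last first.
  by rewrite ffunE /= ffunE normr0 expr0n if_same.
by rewrite [RHS]big_mkcond; apply: eq_bigr => c _; rewrite ffunE.
Qed.
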